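(* Assume $k\ge2\cdot10^8$, the stream is in random order, no dense set exists, and $\Pr[f(S_L)\le\alpha\,\mathrm{OPT}]\ge0.99$ with $\alpha=3\cdot10^{-3}$, where $S_L$ denotes the set of elements selected by Algorithm 2 among the positions $i\le\beta n$, $\beta=10^{-3}$. Then, with probability at least $0.49\,\eta$, the output $S$ of Algorithm 2 satisfies $f(S)\ge\frac{1+\epsilon}{2}\mathrm{OPT}$.
   Context: $V$ is a finite ground set with $|V|=n$; $f:2^V\to\mathbb{R}_{\ge0}$ is monotone, submodular and normalized; $f(X\mid Y)=f(X\cup Y)-f(Y)$, $f(e\mid Y)=f(\{e\}\mid Y)$. $k\le n$ is a positive integer, $\mathrm{OPT}=\max\{f(S):S\subseteq V,|S|\le k\}$, and $\mathcal O$ is a fixed set with $|\mathcal O|=k$, $f(\mathcal O)=\mathrm{OPT}$. A stream is an ordering $e_1,\dots,e_n$ of $V$; ''random order'' means a uniformly random permutation. A set $D$ is dense if $|D|\le\eta k$ and $f(D)\ge\frac{1-\gamma}{2}\mathrm{OPT}$, where $\gamma=10^{-2}$, $\eta=5\cdot10^{-5}$. Algorithm 2 (knows $\mathrm{OPT}$), with $\epsilon=10^{-8}$: start with $S=\emptyset$; for $i=1,\dots,n$, add $e_i$ to $S$ if $|S|<k$ and $f(e_i\mid S)\ge\frac{1+\epsilon}{2}\cdot\frac{\mathrm{OPT}}{k}$; return $S$. *)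

(* Defs.v *)
From HB Require Import structures.
From mathcomp Require Import all_boot all_order all_algebra all_fingroup.
Set Implicit Arguments. Unset Strict Implicit. Unset Printing Implicit Defensive.
Import Order.TTheory GRing.Theory Num.Theory.
Local Open Scope ring_scope.

Definition gamma_c {R : realFieldType} : R := 1 / 100%:R.
Definition eta_c {R : realFieldType} : R := 5%:R / (10%:R ^+ 5).
Definition eps_c {R : realFieldType} : R := 1 / (10%:R ^+ 8).
Definition alpha_c {R : realFieldType} : R := 3%:R / (10%:R ^+ 3).

Section Defs.
Variables (R : realFieldType) (V : finType).
Implicit Types (f : {set V} -> R) (k : nat).

Definition normalized f := f set0 = 0.
Definition nonneg f := forall A : {set V}, 0 <= f A.
Definition monotone f := forall A B : {set V}, A \subset B -> f A <= f B.
Definition submodular f :=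
  forall A B : {set V}, f (A :|: B) + f (A :&: B) <= f A + f B.

Definition marg f (e : V) (S : {set V}) := f (e |: S) - f S.

Definition OPT f k : R := \big[Num.max/0]_(S : {set V} | (#|S| <= k)%N) f S.


Definition dense f k (D : {set V}) :=
  (#|D|%:R : R) <= eta_c * k%:R /\ (1 - gamma_c) / 2%:R * OPT f k <= f D.

Definition stream (s : {perm V}) : seq V := [seq s x | x <- enum V].

Definition alg2_step f k (S : {set V}) (e : V) : {set V} :=
  if (#|S| < k)%N && ((1 + eps_c) / 2%:R * (OPT f k / k%:R) <= marg f e S)
  then e |: S else S.

Definition alg2_run f k (es : seq V) : {set V} := foldl (alg2_step f k) set0 es.

Definition alg2_out f k (s : {perm V}) := alg2_run f k (stream s).

Definition alg2_SL f k (s : {perm V}) :=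
  alg2_run f k (take (#|V| %/ 1000) (stream s)).

End Defs.

Definition Pr {R : realFieldType} {V : finType} (P : {perm V} -> bool) : R :=
  #|[set s : {perm V} | P s]|%:R / #|{perm V}|%:R.

(* Main.v *)
Require Import Defs.
From HB Require Import structures.
From mathcomp Require Import all_boot all_order all_algebra all_fingroup.
From mathcomp Require Import ring lra.
Set Implicit Arguments. Unset Strict Implicit. Unset Printing Implicit Defensive.
Import Order.TTheory GRing.Theory Num.Theory.
Local Open Scope ring_scope.

(* If Algorithm 2 rejects no element for lack of room, every element of O it
   missed has marginal below the threshold tau, so f(S) >= OPT - |O \ S| tau;
   hence it succeeds as soon as it has picked about 2 eps k elements of O.
   While the value stays below alpha OPT, more than eta k elements of O must have
   marginal at least tau, otherwise those that do would form a dense set. So each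
   of the first beta n steps picks an element of O with probability at least
   eta k / n, and the expected number X of elements of O in S_L is at least about
   0.99 beta eta k, well above 2 eps k. On the other hand X is at most the number
   Y of elements of O in the first beta n positions, which exceeds 1.1 beta k with
   exponentially small probability; comparing E[X] with
   2 eps k + 1.1 beta k Pr[success] gives the bound. *)

(** * Marginals of monotone submodular functions *)

Section SetFunction.
Variables (R : realFieldType) (V : finType) (f : {set V} -> R).
Hypotheses (f0 : nonneg f) (fmon : monotone f) (fsub : submodular f).

Lemma marg_ge0 e (S : {set V}) : 0 <= marg f e S.
Proof. by rewrite subr_ge0 fmon ?subsetUr. Qed.

Lemma marg_mem e (S : {set V}) : e \in S -> marg f e S = 0.
Proof. by move=> eS; rewrite /marg (setUidPr _) ?subrr // sub1set. Qed.

(** For [e] outside [B], apply submodularity to [e |: A] and [B], whose intersection is [A]. *)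
Lemma marg_antitone e (A B : {set V}) :
  A \subset B -> marg f e B <= marg f e A.
Proof.
move=> sAB; have [eB|eB] := boolP (e \in B).
  by rewrite marg_mem // marg_ge0.
have := fsub (e |: A) B.
rewrite -setUA (setUidPr sAB) setIUl (setIidPl sAB).
have -> : [set e] :&: B = set0.
  by apply/setP=> x; rewrite !inE; case: eqP => // ->; rewrite (negPf eB).
by rewrite set0U /marg; lra.
Qed.

Lemma subadditive (A B : {set V}) : f (A :|: B) <= f A + f B.
Proof. by have := fsub A B; have := f0 (A :&: B); lra. Qed.

Lemma union_le_marg (S T : {set V}) (c : R) :
  {in T, forall o, marg f o S <= c} -> f (S :|: T) <= f S + #|T|%:R * c.
Proof.
have [m] := ubnP #|T|; elim: m T => // m IHm T Tm Tc.
have [->|[o oT]] := set_0Vmem T; first by rewrite setU0 cards0 mul0r addr0.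
move: Tm Tc; rewrite -(setD1K oT); set T' := T :\ o.
have oT' : o \notin T' by rewrite !inE eqxx.
rewrite cardsU1 oT' /= add1n ltnS => Tm Tc.
have IH := IHm T' Tm.
have /IH : {in T', forall o, marg f o S <= c}.
  by move=> x xT; apply: Tc; rewrite in_setU xT orbT.
have := Tc o (setU11 _ _).
have := @marg_antitone o S (S :|: T') (subsetUl _ _).
rewrite {1}/marg setUCA -addn1 natrD; lra.
Qed.

Lemma OPT_attained k : exists2 O : {set V}, (#|O| <= k)%N & OPT f k <= f O.
Proof.
have k0 : (#|(set0 : {set V})| <= k)%N by rewrite cards0.
case: (arg_maxP (P := fun S : {set V} => (#|S| <= k)%N) f k0) => O Ok Omax.
by exists O => //; apply/bigmax_leP; split.
Qed.

End SetFunction.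

(** * Algorithm 2 on a fixed stream *)

Section Algorithm.
Variables (R : realFieldType) (V : finType) (f : {set V} -> R) (k : nat).
Hypotheses (fn : normalized f) (f0 : nonneg f) (fmon : monotone f).
Hypotheses (fsub : submodular f) (k_gt0 : (0 < k)%N) (OPT_gt0 : 0 < OPT f k).

Let tau : R := (1 + eps_c) / 2%:R * (OPT f k / k%:R).

Definition acceptable (S : {set V}) : {set V} :=
  [set e | (#|S| < k)%N && (tau <= marg f e S)].

Lemma tau_gt0 : 0 < tau.
Proof.
rewrite /tau mulr_gt0 ?divr_gt0 ?ltr0n //; rewrite /eps_c; lra.
Qed.

Lemma tau_k : k%:R * tau = (1 + eps_c) / 2%:R * OPT f k.
Proof. by rewrite /tau; field; rewrite pnatr_eq0 -lt0n k_gt0. Qed.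

Lemma alg2_stepE S e :
  alg2_step f k S e = if e \in acceptable S then e |: S else S.
Proof. by rewrite inE. Qed.

Lemma acceptable_notin S e : e \in acceptable S -> e \notin S.
Proof.
rewrite inE => /andP[_]; apply: contraL => eS.
by rewrite marg_mem // -ltNge tau_gt0.
Qed.

Lemma alg2_run_rcons es e :
  alg2_run f k (rcons es e) = alg2_step f k (alg2_run f k es) e.
Proof. by rewrite /alg2_run foldl_rcons. Qed.

Lemma alg2_run_cat_sub es es' :
  alg2_run f k es \subset alg2_run f k (es ++ es').
Proof.
elim/last_ind: es' => [|es' e IH]; first by rewrite cats0.
rewrite -rcons_cat alg2_run_rcons alg2_stepE; case: ifP => // _.
exact: subset_trans IH (subsetUr _ _).
Qed.

Lemma alg2_run_sub es : {subset alg2_run f k es <= es}.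
Proof.
elim/last_ind: es => [|es e IH] x; first by rewrite inE.
rewrite alg2_run_rcons alg2_stepE mem_rcons in_cons; case: ifP => _.
  by rewrite !inE => /orP[->//|/IH ->]; rewrite orbT.
by move=> /IH ->; rewrite orbT.
Qed.

Lemma alg2_run_value es : #|alg2_run f k es|%:R * tau <= f (alg2_run f k es).
Proof.
elim/last_ind: es => [|es e IH]; first by rewrite cards0 mul0r fn.
rewrite alg2_run_rcons alg2_stepE; case: ifP => // eG.
have eS := acceptable_notin eG.
move: eG; rewrite inE => /andP[_]; rewrite /marg cardsU1 eS /= natrD mulrDl mul1r.
lra.
Qed.

Lemma alg2_run_card es : (#|alg2_run f k es| <= k)%N.
Proof.
elim/last_ind: es => [|es e IH]; first by rewrite cards0.
rewrite alg2_run_rcons alg2_stepE; case: ifP => // eG.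
rewrite cardsU1 acceptable_notin //.
by move: eG; rewrite inE => /andP[].
Qed.

(** Acceptability only shrinks as the selection grows, so a rejected element stays unacceptable; a
    picked one has marginal zero, below [tau]. *)
Lemma acceptable_unseen es e :
  e \in es -> e \notin acceptable (alg2_run f k es).
Proof.
elim/last_ind: es => [//|es e' IH].
rewrite alg2_run_rcons alg2_stepE => ein; apply/negP => eG.
have sub : acceptable (e' |: alg2_run f k es)
             \subset acceptable (alg2_run f k es).
  apply/subsetP=> x; rewrite !inE => /andP[c t]; apply/andP; split.
    by apply: leq_ltn_trans c; rewrite subset_leq_card ?subsetUr.
  by apply: le_trans t _; apply: marg_antitone => //; rewrite subsetUr.
move: ein eG; rewrite mem_rcons in_cons => /orP[/eqP ->|/IH eN]; case: ifP.
- by move=> _ /acceptable_notin; rewrite !inE eqxx.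
- by move=> ->.
- by move=> _ /(subsetP sub); rewrite (negPf eN).
- by move=> _; rewrite (negPf eN).
Qed.

Lemma alg2_run_success es (O : {set V}) :
  (forall e, e \in es) -> (#|O| <= k)%N -> OPT f k <= f O ->
  eps_c * OPT f k <= #|alg2_run f k es :&: O|%:R * tau ->
  (1 + eps_c) / 2%:R * OPT f k <= f (alg2_run f k es).
Proof.
move=> all_es Ok Oopt; set S := alg2_run f k es => X.
have := alg2_run_value es; rewrite -/S => fS.
(* A full selection has value at least [k * tau], which is exactly the target. *)
have [Sk|] := ltnP #|S| k; last first.
  move=> kS; have -> : (1 + eps_c) / 2%:R * OPT f k = #|S|%:R * tau; last by [].
  by rewrite -tau_k; congr (_%:R * _); apply/eqP; rewrite eqn_leq kS alg2_run_card.
have le : {in O :\: S, forall o, marg f o S <= tau}.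
  move=> o _; apply: ltW; have := acceptable_unseen (all_es o).
  by rewrite inE -/S Sk /= -ltNge.
have := union_le_marg fmon fsub le.
have := @fmon O (S :|: (O :\: S)).
have -> : O \subset S :|: (O :\: S).
  by apply/subsetP => x xO; rewrite in_setU in_setD xO andbT orbN.
move=> /(_ isT) fO.
have cO : (#|O :\: S| + #|S :&: O| = #|O|)%N by rewrite -(cardsID S O) setIC addnC.
have cO' : #|O :\: S|%:R + #|S :&: O|%:R <= k%:R :> R.
  by rewrite -natrD cO ler_nat.
(* This yields OPT <= f(S) + (1 + eps)/2 OPT - eps OPT, and 1 - (1 + eps)/2 + eps = (1 + eps)/2. *)
have := ler_wpM2r (ltW tau_gt0) cO'; rewrite tau_k mulrDl.
lra.
Qed.

(** An acceptable element is never already selected, so each counted index brings a new element of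
    [O]. *)
Lemma sum_acceptable_le (O : {set V}) es x0 l : (l <= size es)%N ->
  (\sum_(i < l) (nth x0 es i \in O :&: acceptable (alg2_run f k (take i es)))
    <= #|alg2_run f k (take l es) :&: O|)%N.
Proof.
elim: l => [|l IH] ls; first by rewrite big_ord0.
rewrite big_ord_recr /= (take_nth x0 ls) alg2_run_rcons alg2_stepE in_setI.
apply: leq_trans (leq_add (IH (ltnW ls)) (leqnn _)) _.
case: ifP => [eG|_]; last by rewrite andbF addn0.
have eS := acceptable_notin eG.
rewrite andbT setIUl; case eO: (_ \in O); last first.
  by rewrite addn0 subset_leq_card ?subsetUr.
have -> : [set nth x0 es l] :&: O = [set nth x0 es l] by apply/setIidPl; rewrite sub1set.
by rewrite cardsU1 inE (negPf eS) addnC.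
Qed.

(* Otherwise T, the set of acceptable elements of O, would be dense: the value
   of O is split between S, T and the remaining marginals, all below tau. *)
Lemma card_acceptable (O S : {set V}) :
  ~ (exists D : {set V}, dense f k D) ->
  (#|O| <= k)%N -> OPT f k <= f O -> (#|S| < k)%N -> f S <= alpha_c * OPT f k ->
  (eta_c * k%:R : R) <= #|O :&: acceptable S|%:R.
Proof.
move=> nd Ok Oopt Sk fS; set T := _ :&: _.
rewrite leNgt; apply/negP => Tk; apply: nd; exists T; split; first exact: ltW.
have le : {in O :\: T, forall o, marg f o (S :|: T) <= tau}.
  move=> o; rewrite !inE Sk /= => /andP[nT oO]; move: nT.
  rewrite oO /= -ltNge => /ltW; apply: le_trans.
  by apply: marg_antitone => //; rewrite subsetUl.
have := union_le_marg fmon fsub le.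
have := @fmon O ((S :|: T) :|: (O :\: T)).
have -> : O \subset S :|: T :|: (O :\: T).
  by apply/subsetP => x xO; rewrite !in_setU in_setD xO andbT -orbA orbN orbT.
move=> /(_ isT) h1.
have := subadditive f0 fsub S T.
have cO : #|O :\: T|%:R <= k%:R :> R.
  by rewrite ler_nat (leq_trans _ Ok) // subset_leq_card // subsetDl.
have := ler_wpM2r (ltW tau_gt0) cO; rewrite tau_k.
(* f(T) >= (1 - alpha - (1 + eps)/2) OPT, about 0.497 OPT, above the density bound 0.495 OPT. *)
move: fS; rewrite /alpha_c /eps_c /gamma_c.
move: (_ * tau) (f (S :|: T)) (f (_ :|: _)) (f S) (f T) (f O) (OPT f k)
  h1 Oopt OPT_gt0 => *; lra.
Qed.

End Algorithm.

(** * Random permutations: the next element, and exponential moments of a prefix count *)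

Section RandomOrder.
Variables (V : finType).

Lemma size_stream (s : {perm V}) : size (stream s) = #|V|.
Proof. by rewrite size_map cardE. Qed.

Lemma mem_stream (s : {perm V}) x : x \in stream s.
Proof. by apply/mapP; exists ((s^-1)%g x); rewrite ?mem_enum ?permKV. Qed.

Lemma take_stream_tperm (s : {perm V}) i x y :
  x \notin take i (enum V) -> y \notin take i (enum V) ->
  take i (stream (tperm x y * s)%g) = take i (stream s).
Proof.
move=> xi yi; rewrite /stream -[LHS]map_take -[RHS]map_take; apply/eq_in_map => z zi.
by rewrite permM tpermD //; [apply: contraNneq xi|apply: contraNneq yi] => ->.
Qed.

(* Swapping position x with another position past the prefix preserves the
   prefix, so each of the #|g| favourable positions is as likely to be x. *)
Lemma sum_card_next (g : seq V -> {set V}) x0 i : (i < #|V|)%N ->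
  (forall (s : {perm V}) x, x \in take i (stream s) -> x \notin g (take i (stream s))) ->
  (\sum_(s : {perm V}) #|g (take i (stream s))|
    <= #|V| * \sum_(s : {perm V}) (nth x0 (stream s) i \in g (take i (stream s))))%N.
Proof.
move=> iV gN; have iE : (i < size (enum V))%N by rewrite -cardE.
set x := nth x0 (enum V) i.
have xi : x \notin take i (enum V).
  have := enum_uniq V; rewrite -{1}(cat_take_drop i (enum V)) (drop_nth x0 iE).
  by rewrite cat_uniq /= negb_or => /and3P[_ /andP[]].
have -> : (\sum_(s : {perm V}) #|g (take i (stream s))|
  = \sum_(y : V) \sum_(s : {perm V}) (s y \in g (take i (stream s))))%N.
  rewrite exchange_big; apply: eq_bigr => s _.
  rewrite -sum1_card (reindex_inj (@perm_inj _ s)) big_mkcond.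
  by apply: eq_bigr => y _; case: ifP.
have -> : #|V| = (\sum_(y : V) 1)%N by rewrite sum1_card.
rewrite big_distrl; apply: leq_sum => y _; rewrite /= mul1n.
have [yi|yi] := boolP (y \in take i (enum V)).
  rewrite big1 // => s _; apply/eqP; rewrite eqb0; apply: gN.
  by rewrite -[take i (stream s)]map_take map_f.
(* The swap turns [s y] into [s x], the stream entry at index [i]. *)
rewrite (reindex_inj (mulgI (tperm x y))); apply: leq_sum => s _.
by rewrite take_stream_tperm // permM tpermR (nth_map x0).
Qed.

(** Positions are indexed by [V] itself, so [s @: P] is the random set of elements that occupy the
    positions in [P]. *)
Definition covers (B P : {set V}) (s : {perm V}) := B \subset s @: P.

(** Negative dependence: given that [B] is covered, [v] is covered with probability (|P| - |B|)/(|V|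
    - |B|), at most |P|/|V|. *)
Lemma sum_covers_setU1 (B P : {set V}) v : v \notin B ->
  ((\sum_(s : {perm V}) covers (v |: B) P s) * #|V|
    <= #|P| * \sum_(s : {perm V}) covers B P s)%N.
Proof.
move=> vB; set W := (\sum_s _)%N; set W0 := (\sum_s _)%N.
(* All [u] outside [B] are exchangeable: composing with [tperm u v] swaps [u] and [v] and fixes
   [B]. *)
have sym u : u \notin B -> (\sum_(s : {perm V}) covers (u |: B) P s = W)%N.
  move=> uB; rewrite (reindex_inj (mulIg (tperm u v))).
  apply: eq_bigr => s _; congr nat_of_bool.
  have tB : tperm u v @: (v |: B) = u |: B.
    rewrite imsetU1 tpermR; congr (_ |: _).
    rewrite -[RHS]imset_id; apply: eq_in_imset => z zB.
    by rewrite tpermD //; [apply: contraNneq uB|apply: contraNneq vB] => ->.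
  rewrite /covers -tB.
  have -> : (s * tperm u v)%g @: P = tperm u v @: (s @: P).
    by rewrite -imset_comp; apply: eq_imset => z; rewrite permM.
  apply/subsetP/subsetP => H z.
    by move=> /(imset_f (tperm u v))/H; rewrite mem_imset //; exact: perm_inj.
  by case/imsetP=> w /H wP ->; apply: imset_f.
(* Double count the pairs of [u] outside [B] and [s] covering [u |: B]: when [s] covers [B], the
   valid [u] form [s @: P] minus [B]. *)
have key : ((#|V| - #|B|) * W = (#|P| - #|B|) * W0)%N.
  have -> : (#|V| - #|B|)%N = #|~: B| by rewrite [RHS]cardsCs setCK.
  rewrite -sum_nat_const.
  rewrite (eq_bigr (fun u => \sum_(s : {perm V}) covers (u |: B) P s)%N); last first.
    by move=> u; rewrite inE => /sym.
  rewrite exchange_big big_distrr; apply: eq_bigr => s _ /=.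
  have [Bs|Bs] := boolP (covers B P s); last first.
    rewrite muln0 big1 // => u _; apply/eqP; rewrite eqb0.
    by apply: contra Bs; apply: subset_trans (subsetUr _ _).
  rewrite muln1 -(card_imset P (@perm_inj _ s)) -(cardsDS Bs) -sum1_card.
  rewrite big_mkcond [RHS]big_mkcond; apply: eq_bigr => u _.
  rewrite !inE; case: (u \in B) => //=.
  by rewrite /covers subUset sub1set -/(covers B P s) Bs andbT; case: (_ \in _).
have BV : (#|B| < #|V|)%N.
  by rewrite -cardsT; apply: proper_card; rewrite properT; apply: contraNneq vB => ->.
have PV : (#|P| <= #|V|)%N by exact: max_card.
move: key BV PV; clearbody W W0; clear; move: #|V| #|P| #|B| => n p b key bn pn.
rewrite -(@leq_pmul2l (n - b)%N) ?subn_gt0 // mulnA key.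
rewrite mulnAC [in leqRHS]mulnA leq_mul2r; apply/orP; right.
by rewrite !mulnBl (mulnC n p) leq_sub2l // leq_mul2l pn orbT.
Qed.

Variable R : realFieldType.

(** The moment is bounded as if the elements were covered independently. Each factor is 1 + t times
    the indicator that [v] is covered; the indicator is absorbed by moving [v] into [B], which is
    why [B] is general in the induction. *)
Lemma sum_covers_exp (t : R) (P O B : {set V}) : 0 <= t -> [disjoint B & O] ->
  \sum_(s : {perm V}) (covers B P s)%:R * (1 + t) ^+ #|O :&: s @: P|
   <= (1 + t * (#|P|%:R / #|V|%:R)) ^+ #|O| * \sum_(s : {perm V}) (covers B P s)%:R.
Proof.
move=> t0; have [m] := ubnP #|O|; elim: m O B => // m IH O B.
have [->|[v vO]] := set_0Vmem O.
  move=> _ _; rewrite cards0 expr0 mul1r.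
  by apply: ler_sum => s _; rewrite set0I cards0 expr0 mulr1.
rewrite -(setD1K vO); set O' := O :\ v.
have vO' : v \notin O' by rewrite !inE eqxx.
rewrite cardsU1 vO' add1n ltnS => Om; rewrite disjoint_sym.
rewrite -setI_eq0 setIUl setU_eq0 !setI_eq0 disjoints1.
case/andP=> vB dB; rewrite disjoint_sym in dB.
have d1 : [disjoint v |: B & O'].
  by rewrite -setI_eq0 setIUl setU_eq0 !setI_eq0 disjoints1 vO' dB.
have := IH _ _ Om dB; have := IH _ _ Om d1.
have split (s : {perm V}) :
  (covers B P s)%:R * (1 + t) ^+ #|(v |: O') :&: s @: P|
  = (covers B P s)%:R * (1 + t) ^+ #|O' :&: s @: P|
    + t * ((covers (v |: B) P s)%:R * (1 + t) ^+ #|O' :&: s @: P|).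
  rewrite /covers subUset sub1set setIUl.
  have [vP|vP] := boolP (v \in s @: P).
    have -> : [set v] :&: s @: P = [set v] by apply/setIidPl; rewrite sub1set.
    by rewrite cardsU1 inE (negPf vO') exprS; ring.
  have -> : [set v] :&: s @: P = set0.
    by apply/setP=> x; rewrite !inE; case: eqP => // ->; rewrite (negPf vP).
  by rewrite set0U mul0r mulr0 addr0.
rewrite (eq_bigr _ (fun s _ => split s)) big_split -mulr_sumr /=.
set G1 := \sum_s _; set W1 := \sum_s _; set G := \sum_s _; set W := \sum_s _.
set e := (1 + _) ^+ _ => h1 h0.
have V0 : 0 < #|V|%:R :> R by rewrite ltr0n; apply/card_gt0P; exists v.
have : W1 <= #|P|%:R / #|V|%:R * W.
  have := sum_covers_setU1 P vB; rewrite -(ler_nat R) !natrM !natr_sum.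
  by rewrite -/W -/W1 (mulrAC _ _ W) ler_pdivlMr.
have e0 : 0 <= e by rewrite exprn_ge0 // addr_ge0 // mulr_ge0 // divr_ge0.
move=> /(ler_wpM2l e0) h2; rewrite exprS -/e.
have := ler_wpM2l t0 (le_trans h1 h2).
lra.
Qed.

Lemma card_cover_exp (t : R) (P O : {set V}) : 0 <= t ->
  \sum_(s : {perm V}) (1 + t) ^+ #|O :&: s @: P|
   <= (1 + t * (#|P|%:R / #|V|%:R)) ^+ #|O| * #|{perm V}|%:R.
Proof.
move=> t0; have d0 (A : {set V}) : [disjoint set0 & A] by rewrite -setI_eq0 set0I.
have := sum_covers_exp P t0 (d0 O).
have c1 (s : {perm V}) : covers set0 P s by rewrite /covers sub0set.
have -> : \sum_(s : {perm V}) (covers set0 P s)%:R = #|{perm V}|%:R :> R.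
  by rewrite (eq_bigr (fun=> 1)) ?sumr_const // => s _; rewrite c1.
by apply: le_trans; apply: ler_sum => s _; rewrite c1 mul1r.
Qed.
End RandomOrder.

(** * Numerical estimates for the tail *)

Section Numerics.
Variable R : realFieldType.

Lemma bernoulli (t : R) m : -1 <= t -> 1 + m%:R * t <= (1 + t) ^+ m.
Proof.
move=> t1; elim: m => [|m IH]; first by rewrite mul0r addr0 expr0.
have : 0 <= m%:R * (t * t) by rewrite mulr_ge0 // -expr2 sqr_ge0.
have s0 : 0 <= 1 + t by lra.
have := ler_wpM2l s0 IH.
rewrite exprS -natr1; lra.
Qed.

(** Bernoulli with exponent [y - c]: a Chernoff bound on the excess over [c], in a form ready to be
    averaged. *)
Lemma exp_overshoot (t : R) y c : 0 < t ->
  y%:R <= c%:R + (1 + t) ^+ y / (t * (1 + t) ^+ c).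
Proof.
move=> t0; have t1 : 0 < 1 + t by lra.
have [yc|/ltnW cy] := leqP y c.
  have : 0 <= (1 + t) ^+ y / (t * (1 + t) ^+ c).
    by rewrite divr_ge0 ?mulr_ge0 ?exprn_ge0 // ltW.
  by move: yc; rewrite -(ler_nat R); lra.
rewrite -lerBlDl -natrB // ler_pdivlMr ?mulr_gt0 ?exprn_gt0 //.
rewrite -{2}(subnK cy) exprD mulrA ler_pM2r ?exprn_gt0 //.
by have := @bernoulli t (y - c)%N ltac:(lra); lra.
Qed.

(** Per unit of [J], the left power grows by about e^10 and the right by 1.1^110, a ratio above 3/2;
    then (3/2)^J >= 1 + J/2 >= 1001. The exponents are nested products so that only small powers are
    computed. *)
Lemma power_gap J : 2000%:R <= J%:R :> R ->
  1001%:R * (1 + 1 / 10000%:R) ^+ (100 * (10 * (10 * (10 * J))))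
    <= (1 + 1 / 10%:R) ^+ (11 * (10 * J)) :> R.
Proof.
move=> J2.
have pw (a b : R) m : 0 <= a -> a <= b -> a ^+ m <= b ^+ m.
  by move=> a0 ab; rewrite lerXn2r // nnegrE // (le_trans a0).
have e0 : 1001%:R <= (3%:R / 2%:R) ^+ J :> R.
  have -> : 3%:R / 2%:R = 1 + 1 / 2%:R :> R by lra.
  by apply: le_trans (@bernoulli _ J _); lra.
have p0 : 0 <= 1 + 1 / 10000%:R :> R by lra.
have q0 : 0 <= 2735%:R / 1000%:R :> R by lra.
have r0 : 0 <= 2853%:R / 1000%:R :> R by lra.
have s0 : 0 <= 3%:R / 2%:R :> R by lra.
have e1 : (1 + 1 / 10000%:R) ^+ 100 <= 100%:R / 99%:R :> R.
  have -> : 1 + 1 / 10000%:R = (1 + - (1 / 10001%:R))^-1 :> R by field.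
  have b := @bernoulli (- (1 / 10001%:R)) 100 ltac:(lra).
  rewrite exprVn -[leLHS]div1r ler_pdivrMr; last by rewrite exprn_gt0; lra.
  lra.
have e2 : (100%:R / 99%:R) ^+ 10 <= 11058%:R / 10000%:R :> R by lra.
have e3 : (11058%:R / 10000%:R) ^+ 10 <= 2735%:R / 1000%:R :> R by lra.
have e4 : 2853%:R / 1000%:R <= (1 + 1 / 10%:R) ^+ 11 :> R by lra.
have e5 : 3%:R / 2%:R * (2735%:R / 1000%:R) ^+ 10
    <= (2853%:R / 1000%:R) ^+ 10 :> R by lra.
rewrite !exprM.
apply: le_trans (_ : _ <= ((2853%:R / 1000%:R) ^+ 10) ^+ J) _; last first.
  by apply: (pw); [rewrite exprn_ge0|apply: (pw)].
apply: le_trans (pw _ _ J _ e5); last by rewrite mulr_ge0 ?exprn_ge0.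
rewrite [leRHS]exprMn ler_pM ?exprn_ge0 //.
apply: (pw); first by rewrite !exprn_ge0.
apply: (pw); first by rewrite !exprn_ge0.
apply: le_trans e3; apply: (pw); first by rewrite !exprn_ge0.
by apply: le_trans e2; apply: (pw); first by rewrite exprn_ge0.
Qed.

Lemma tail_le (q : R) k J : 0 <= q -> q <= 1 / 1000%:R ->
  (k <= 100 * (10 * (10 * (10 * J))))%N -> 2000%:R <= J%:R :> R ->
  (1 + 1 / 10%:R * q) ^+ k / (1 / 10%:R * (1 + 1 / 10%:R) ^+ (11 * (10 * J)))
    <= 1 / 100%:R.
Proof.
move=> q0 q1 kJ J2; set x := 1 + _.
have x1 : 1 <= x by rewrite /x; lra.
have := power_gap J2; move: kJ; move: (100 * _)%N (11 * _)%N => a b kJ.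
have : x ^+ k <= (1 + 1 / 10000%:R) ^+ a.
  apply: le_trans (ler_weXn2l x1 kJ) _.
  by rewrite lerXn2r ?nnegrE /x; lra.
have : 0 < (1 + 1 / 10%:R) ^+ b :> R by rewrite exprn_gt0 //; lra.
have : 0 <= x ^+ k by rewrite exprn_ge0 //; lra.
move: (x ^+ k) (_ ^+ a) (_ ^+ b) => X A B X0 B0 XA AB.
rewrite ler_pdivrMr; last by rewrite mulr_gt0 //; lra.
lra.
Qed.
End Numerics.

(** * Lower bound on the expected number of hits of [O] *)

Section Hits.
Variables (R : realFieldType) (V : finType) (f : {set V} -> R) (k : nat).
Hypotheses (fn : normalized f) (f0 : nonneg f) (fmon : monotone f).
Hypotheses (fsub : submodular f) (k_gt0 : (0 < k)%N) (OPT_gt0 : 0 < OPT f k).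
Hypothesis no_dense : ~ (exists D : {set V}, dense f k D).

(** A full selection would be worth at least (1 + eps)/2 OPT, more than alpha OPT. *)
Lemma small_value_card es :
  f (alg2_run f k es) <= alpha_c * OPT f k -> (#|alg2_run f k es| < k)%N.
Proof.
move=> fS; rewrite ltnNge; apply/negP => kS.
have := alg2_run_value fn k_gt0 OPT_gt0 es.
have := tau_gt0 k_gt0 OPT_gt0; set tau := _ * _ => tau0.
have := tau_k f k_gt0; rewrite -/tau => tk.
rewrite -(ler_nat R) in kS.
have := ler_wpM2r (ltW tau0) kS; rewrite tk.
move: (_ * tau) OPT_gt0 fS; rewrite /alpha_c /eps_c.
move: (f _) (OPT f k) => *; lra.
Qed.

(* On the event that the value stays small, each of the first l steps hits one
   of the eta k acceptable elements of O with probability at least eta k / n. *)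
Lemma sum_hits_ge (O : {set V}) l :
  (#|O| <= k)%N -> OPT f k <= f O -> (l <= #|V|)%N ->
  l%:R * (#|[set s : {perm V} | f (alg2_run f k (take l (stream s)))
                 <= alpha_c * OPT f k]|%:R * (eta_c * k%:R)) <=
  #|V|%:R * \sum_(s : {perm V}) #|alg2_run f k (take l (stream s)) :&: O|%:R :> R.
Proof.
move=> Ok Oopt lV; case: (posnP l) => [->|l0].
  by rewrite mul0r mulr_ge0 ?sumr_ge0.
have [x0 _] : exists x0 : V, x0 \in V by apply/card_gt0P; apply: leq_trans lV.
pose g es := O :&: acceptable f k (alg2_run f k es).
have gN (i : nat) (s : {perm V}) x :
    x \in take i (stream s) -> x \notin g (take i (stream s)).
  by move=> xi; rewrite inE negb_and acceptable_unseen ?orbT.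
have hits : (\sum_(i < l) \sum_(s : {perm V}) #|g (take i (stream s))| <=
   #|V| * \sum_(s : {perm V}) #|alg2_run f k (take l (stream s)) :&: O|)%N.
  apply: leq_trans (_ : _ <= \sum_(i < l) #|V| * \sum_(s : {perm V})
     (nth x0 (stream s) i \in g (take i (stream s))))%N _.
    by apply: leq_sum => i _; apply: sum_card_next (gN i); apply: leq_trans lV.
  rewrite -big_distrr leq_mul2l exchange_big /=; apply/orP; right.
  by apply: leq_sum => s _; apply: sum_acceptable_le; rewrite ?size_stream.
move: hits; rewrite -(ler_nat R) natrM !natr_sum; apply: le_trans.
rewrite mulr_natl -[X in _ *+ X]card_ord -sumr_const; apply: ler_sum => i _.
rewrite natr_sum mulr_natl -sumr_const big_mkcond; apply: ler_sum => s _.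
rewrite inE; case: ifP => // sH.
(* The value only grows along the stream, so it is small at every earlier step. *)
have fi : f (alg2_run f k (take i (stream s))) <= alpha_c * OPT f k.
  apply: le_trans sH; apply: fmon.
  have -> : take l (stream s) = take i (stream s) ++ drop i (take l (stream s)).
    by rewrite -{1}(cat_take_drop i (take l _)) take_takel // ltnW.
  exact: alg2_run_cat_sub.
exact: card_acceptable (small_value_card fi) fi.
Qed.

End Hits.

(* n, l, k, c stand for |V|, |V| %/ 1000, k and the overshoot cut-off; a success
   probability p below 0.49 eta would make the expected number of hits of O too
   small. *)
Lemma success_prob_arith (R : realFieldType) (n l k c p x : R) :
  2%:R * 10%:R ^+ 8 <= k -> k <= n -> n / 1000%:R - 1 <= l ->
  c <= 11%:R / 10000%:R * k + 110%:R -> 0 <= p ->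
  99%:R / 100%:R * l * (eta_c * k) <= n * x ->
  x <= 2%:R * eps_c * k + p * c + 1 / 100%:R ->
  49%:R / 100%:R * eta_c <= p.
Proof.
move=> k8 kn ln ck p0 lx xle; rewrite leNgt; apply/negP => pl.
have n0 : 0 < n by lra.
have c0 : 0 <= 11%:R / 10000%:R * k + 110%:R by lra.
have pc : p * c <= 49%:R / 100%:R * eta_c * (11%:R / 10000%:R * k + 110%:R).
  by apply: le_trans (ler_wpM2l p0 ck) _; apply: (ler_wpM2r c0); apply: ltW.
(* The rounding loss 1 is at most n / (2 * 10^8). *)
have l2 : n * (1 / 1000%:R - 1 / (2%:R * 10%:R ^+ 8)) <= l by lra.
have ek : 0 <= 99%:R / 100%:R * (eta_c * k) by rewrite /eta_c; lra.
have := ler_wpM2r ek l2.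
have -> : l * (99%:R / 100%:R * (eta_c * k)) = 99%:R / 100%:R * l * (eta_c * k).
  by ring.
move=> /le_trans/(_ lx); rewrite -[leLHS]mulrA ler_pM2l // => h.
(* The lower bound is about 4.95e-8 k, the upper one about (2 + 2.695)e-8 k + 0.013; the gap 2.55e-9
   k is about 0.5 already at k = 2 * 10^8. *)
have := le_trans h xle; rewrite /eta_c /eps_c in pc *.
lra.
Qed.

Theorem mainTheorem9 (R : realFieldType) (V : finType) (f : {set V} -> R)
  (k : nat) :
  normalized f -> nonneg f -> monotone f -> submodular f ->
  (0 < k)%N -> (k <= #|V|)%N -> (2 * 10 ^ 8 <= k)%N ->
  ~ (exists D : {set V}, dense f k D) ->
  (99%:R / 100%:R : R) <= Pr (fun s => f (alg2_SL f k s) <= alpha_c * OPT f k) ->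
  (49%:R / 100%:R : R) * eta_c <= Pr (fun s => (1 + eps_c) / 2%:R * OPT f k <= f (alg2_out f k s)).
Proof.
move=> fn f0 fmon fsub k0 kV.
rewrite -(ler_nat R) natrM natrX => k8R nd good.
(* If OPT were zero, the empty set would be dense. *)
have OPT0 : 0 < OPT f k.
  rewrite ltNge; apply/negP => OPTle; apply: nd; exists set0; split.
    by rewrite cards0 mulr_ge0 // /eta_c divr_ge0 ?exprn_ge0.
  by apply: le_trans (f0 _); rewrite mulr_ge0_le0 // /gamma_c; lra.
have [O Ok Oopt] := OPT_attained f0 k.
set A := fun s : {perm V} => _ <= f (alg2_out f k s).
pose l := (#|V| %/ 1000)%N; pose P := [set x in take l (enum V)].
have lV : (l <= #|V|)%N by exact: leq_div.
have PE : #|P| = l.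
  by rewrite cardsE (card_uniqP _) ?take_uniq ?enum_uniq // size_takel -?cardE.
pose X (s : {perm V}) := #|alg2_SL f k s :&: O|.
pose Y (s : {perm V}) := #|O :&: s @: P|.
have XY s : (X s <= Y s)%N.
  rewrite /X setIC; apply/subset_leq_card/setIS/subsetP => x /alg2_run_sub.
  rewrite -[take _ _]map_take => /mapP[y yl ->].
  by rewrite imset_f // inE.
(* 2 eps k picks from [O] suffice, since 2 eps k [tau] = eps (1 + eps) OPT >= eps OPT. *)
have miss s : ~~ A s -> (X s)%:R <= 2%:R * eps_c * k%:R :> R.
  apply: contraNT; rewrite -ltNge => Xs; rewrite /A /alg2_out.
  apply: (alg2_run_success fn fmon fsub k0 OPT0 (mem_stream s) Ok Oopt).
  have X_le : (X s)%:R <= #|alg2_run f k (stream s) :&: O|%:R :> R.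
    rewrite ler_nat subset_leq_card // setSI // /alg2_SL.
    by rewrite -{2}(cat_take_drop l (stream s)) alg2_run_cat_sub.
  apply: le_trans (ler_wpM2r (ltW (tau_gt0 k0 OPT0)) (le_trans (ltW Xs) X_le)).
  rewrite -[leRHS]mulrA (tau_k f k0) mulrA ler_wpM2r ?(ltW OPT0) // /eps_c; lra.
pose d := (100 * (10 * (10 * 10)))%N.
(* [J] rounds k / 10^5 up, so [c] = 110 [J] is 1.1 beta k up to an additive 110. *)
pose J := (k %/ d).+1; pose c := (11 * (10 * J))%N.
have d0 : (0 < d)%N by [].
have kJ : (k <= 100 * (10 * (10 * (10 * J))))%N.
  by apply: leq_trans (ltnW (ltn_ceil k d0)) _; rewrite mulnC /d -!mulnA.
have J_ge : 2000%:R <= J%:R :> R.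
  by move: kJ; rewrite -(ler_nat R) !natrM; lra.
pose t : R := 1 / 10%:R.
have t0 : 0 < t by rewrite /t; lra.
have t1 : 0 < 1 + t by rewrite /t; lra.
(* On success X <= Y, which is at most [c] plus the overshoot; on failure [miss] bounds X. *)
have pointwise s : (X s)%:R <= 2%:R * eps_c * k%:R + (A s)%:R * c%:R
                       + (1 + t) ^+ Y s / (t * (1 + t) ^+ c).
  have XYR : (X s)%:R <= (Y s)%:R :> R by rewrite ler_nat.
  have e0 : 0 <= 2%:R * eps_c * k%:R :> R by rewrite /eps_c; lra.
  have y0 : 0 <= (1 + t) ^+ Y s / (t * (1 + t) ^+ c).
    by apply/ltW/divr_gt0; [|apply: mulr_gt0 => //]; apply: exprn_gt0.
  have := exp_overshoot (Y s) c t0.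
  have [As|/miss] := boolP (A s).
    by rewrite mul1r; move: y0 XYR e0; move: (_ / _) (_ * k%:R) => *; lra.
  by rewrite mul0r; move: y0; move: (_ / _) (_ * k%:R) => *; lra.
have N0 : 0 < #|{perm V}|%:R :> R.
  by rewrite ltr0n; apply/card_gt0P; exists 1%g.
have up : (\sum_s (X s)%:R) / #|{perm V}|%:R
    <= 2%:R * eps_c * k%:R + Pr A * c%:R + 1 / 100%:R :> R.
  rewrite ler_pdivrMr //.
  apply: le_trans (ler_sum _ (fun s _ => pointwise s)) _.
  rewrite !big_split /= sumr_const -!mulr_suml.
  rewrite [leRHS]mulrDl [X in _ <= X + _]mulrDl !lerD //.
  - by rewrite [leRHS]mulr_natr.
  - by rewrite mulrAC /Pr divfK ?gt_eqF // -natr_sum -sum1dep_card [in leRHS]big_mkcond.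
  (* The mean overshoot is bounded by the exponential moment with t = 1/10 and density [l] / |V| <=
     1/1000. *)
  have D0 : 0 < t * (1 + t) ^+ c by rewrite mulr_gt0 // exprn_gt0.
  rewrite ler_pdivrMr // mulrAC.
  apply: le_trans (card_cover_exp P O (ltW t0)) (ler_wpM2r (ltW N0) _).
  rewrite PE -ler_pdivrMr //; apply: tail_le => //.
  - by rewrite divr_ge0.
  - rewrite ler_pdivrMr; last by rewrite ltr0n (leq_trans k0).
    by have := leq_trunc_div #|V| 1000; rewrite -(ler_nat R) natrM -/l; clear; lra.
  exact: leq_trans Ok kJ.
apply: (@success_prob_arith R #|V|%:R l%:R k%:R c%:R (Pr A)
          ((\sum_s (X s)%:R) / #|{perm V}|%:R)) => //.
- by rewrite ler_nat.
- have : (#|V| <= l.+1 * 1000)%N by apply/ltnW/ltn_ceil.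
  by rewrite -(ler_nat R) natrM -natr1; clear; lra.
- have : (k %/ d * d <= k)%N by exact: leq_trunc_div.
  by rewrite -(ler_nat R) /c /J !natrM -natr1; clear; lra.
- by rewrite divr_ge0.
rewrite [leRHS]mulrA ler_pdivlMr //.
apply: le_trans (sum_hits_ge fn f0 fmon fsub k0 OPT0 nd Ok Oopt lV).
have -> : 99%:R / 100%:R * l%:R * (eta_c * k%:R) * #|{perm V}|%:R
    = l%:R * (99%:R / 100%:R * #|{perm V}|%:R * (eta_c * k%:R)) :> R by ring.
apply: ler_wpM2l => //; apply: ler_wpM2r; last by rewrite -ler_pdivlMr.
by rewrite mulr_ge0 // /eta_c divr_ge0 // exprn_ge0.
Qed.
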